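(* Let $S:\mathbb{R}^n\rightrightarrows\mathbb{R}^m$ be a set-valued mapping, $\bar{x}\in X\subset\mathbb{R}^n$ and $\bar{u}\in S(\bar{x})$. Suppose that $\operatorname{gph}S$ is locally closed at $(\bar{x},\bar{u})$ and that $X$ is closed and convex. The following properties are equivalent: (a) $S$ has the Lipschitz-like property relative to $X$ at $\bar{x}$ for $\bar{u}$. (b) There is some $\kappa\ge0$ such that the condition $$\|\operatorname{proj}_{T_X(x)}(x^* )\|\le\kappa\|u^*\|\qquad\text{for all } u^*\in\mathbb{R}^m\text{ and all } x^*\in D^*S|_X(x\mid u)(u^* )\tag{1}$$ holds for all $(x,u)$ close enough to $(\bar{x},\bar{u})$ in $\operatorname{gph}S|_X$. Moreover, $$\operatorname{lip}_XS(\bar{x}\mid\bar{u})=\limsup_{(x,u)\to(\bar{x},\bar{u}),\ (x,u)\in\operatorname{gph}S|_X}\ \sup_{u^*\in\mathbb{B}}\ \sup_{x^*\in D^*S|_X(x\mid u)(u^* )}\|\operatorname{proj}_{T_X(x)}(x^* )\|.\tag{2}$$ Alternatively, the coderivative $D^*S|_X(x\mid u)$ in (1) as well as in (2) can be equivalently replaced by the regular coderivative $\widehat{D}^*S|_X(x\mid u)$ or by the proximal coderivative $D^{*\mathrm{prox}}S|_X(x\mid u)$.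
   Context: $\|\cdot\|$ is the Euclidean norm, $\mathbb{B}$ the closed unit ball. A set $A$ is locally closed at $x\in A$ if $A\cap U$ is closed for some closed neighborhood $U$ of $x$. $\operatorname{proj}_A(x)$ is the set of points of $A$ nearest to $x$ (a single point, identified with its element, when $A$ is nonempty closed convex). $\operatorname{gph}S=\{(x,u)\mid u\in S(x)\}$. The restricted mapping $S|_X$ is $S|_X(x)=S(x)$ if $x\in X$ and $\emptyset$ otherwise, so $\operatorname{gph}S|_X=\operatorname{gph}S\cap(X\times\mathbb{R}^m)$. Lipschitz-like property relative to $X$ at $\bar x$ for $\bar u$: $\operatorname{gph}S$ is locally closed at $(\bar{x},\bar{u})$ and there are neighborhoods $V$ of $\bar{x}$, $W$ of $\bar{u}$ and a constant $\kappa\ge0$ such that $S(x')\cap W\subset S(x)+\kappa\|x'-x\|\mathbb{B}$ for all $x,x'\in X\cap V$. The graphical modulus $\operatorname{lip}_XS(\bar{x}\mid\bar{u})$ is the infimum of all $\kappa\ge0$ for which there exist neighborhoods $V$ of $\bar{x}$ and $W$ of $\bar{u}$ such that this inclusion holds for all $x,x'\in X\cap V$ (with $\inf\emptyset=+\infty$). The limsup in (2) is the upper limit over points $(x,u)\in\operatorname{gph}S|_X$ tending to $(\bar x,\bar u)$, the point $(\bar x,\bar u)$ itself being allowed. For $x\in A$: the tangent (contingent) cone $T_A(x)$ consists of all $w$ for which there exist $t_k\downarrow0$, $w_k\to w$ with $x+t_kw_k\in A$ for all $k$; the proximal normal cone is $N_A^{\mathrm{prox}}(x)=\{v\mid\exists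 t>0: x\in\operatorname{proj}_A(x+tv)\}$; the regular normal cone is $\widehat{N}_A(x)=\{v\mid\langle v,w\rangle\le0\ \forall w\in T_A(x)\}$; the (limiting) normal cone $N_A(x)$ consists of all $v$ for which there exist $x_k\to x$, $v_k\to v$ with $x_k\in A$, $v_k\in\widehat{N}_A(x_k)$. For a set-valued mapping $M$ and $(x,u)\in\operatorname{gph}M$, the coderivative, regular coderivative and proximal coderivative are defined by: $x^*\in D^*M(x\mid u)(u^* )\iff(x^*,-u^* )\in N_{\operatorname{gph}M}(x,u)$; $x^*\in\widehat{D}^*M(x\mid u)(u^* )\iff(x^*,-u^* )\in\widehat{N}_{\operatorname{gph}M}(x,u)$; $x^*\in D^{*\mathrm{prox}}M(x\mid u)(u^* )\iff(x^*,-u^* )\in N^{\mathrm{prox}}_{\operatorname{gph}M}(x,u)$. Suprema over empty sets of norms are $0$. *)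

(* Defs.v *)
From HB Require Import structures.
From mathcomp Require Import all_boot all_order all_algebra.
From mathcomp Require Import mathcomp_extra boolp classical_sets functions.
From mathcomp Require Import reals ereal topology normedtype sequences convex.

Set Implicit Arguments.
Unset Strict Implicit.
Unset Printing Implicit Defensive.

Import Order.TTheory GRing.Theory Num.Theory.
Import numFieldNormedType.Exports.

Local Open Scope classical_set_scope.
Local Open Scope ring_scope.

(* The library norm on 'rV[R]_d is the sup norm.  The Euclidean norm is defined
   below and used for all metric notions; both norms induce the topology of
   'rV[R]_d, to which [nbhs], [closed] and [-->] refer. *)
Section Euclidean.
Variables (R : realType) (d : nat).
Implicit Types (A : set 'rV[R]_d) (x v w : 'rV[R]_d).

Definition dotv v w : R := \sum_(i < d) v 0 i * w 0 i.

Definition enorm v : R := Num.sqrt (dotv v v).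

Definition unit_ball : set 'rV[R]_d := [set v | enorm v <= 1].

Definition locally_closed_at A x : Prop :=
  exists U : set 'rV[R]_d, [/\ nbhs x U, closed U & closed (A `&` U)].

Definition projset A x : set 'rV[R]_d :=
  [set y | A y /\ forall z, A z -> enorm (x - y) <= enorm (x - z)].

(* The element of [projset A x] when this set is a singleton, in particular
   when A is nonempty, closed and convex. *)
Definition projpt A x : 'rV[R]_d := xget 0 (projset A x).

Definition tangent_cone A x : set 'rV[R]_d :=
  [set w | exists (t_ : nat -> R) (w_ : nat -> 'rV[R]_d),
     [/\ forall k, 0 < t_ k, t_ @ \oo --> (0 : R), w_ @ \oo --> w &
         forall k, A (x + t_ k *: w_ k)]].

(* The normal cones are meant for x in A only. *)
Definition prox_normal_cone A x : set 'rV[R]_d :=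
  [set v | exists2 t : R, 0 < t & projset A (x + t *: v) x].

Definition regular_normal_cone A x : set 'rV[R]_d :=
  [set v | forall w, tangent_cone A x w -> dotv v w <= 0].

Definition normal_cone A x : set 'rV[R]_d :=
  [set v | exists (x_ v_ : nat -> 'rV[R]_d),
     [/\ x_ @ \oo --> x, v_ @ \oo --> v, forall k, A (x_ k) &
         forall k, regular_normal_cone A (x_ k) (v_ k)]].

End Euclidean.

(* R^n x R^m is represented by 'rV[R]_(n + m), the pair (x, u) being
   [row_mx x u], so that the product carries its Euclidean norm. *)
Section Mappings.
Variables (R : realType) (n m : nat).
Implicit Types (S M : 'rV[R]_n -> set 'rV[R]_m) (X : set 'rV[R]_n).

Definition gph M : set 'rV[R]_(n + m) := [set z | M (lsubmx z) (rsubmx z)].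

Definition restr S X : 'rV[R]_n -> set 'rV[R]_m := patch (fun=> set0) X S.

Definition lip_inclusion S X (xbar : 'rV[R]_n) (ubar : 'rV[R]_m)
    (kappa : R) : Prop :=
  exists (V : set 'rV[R]_n) (W : set 'rV[R]_m),
    [/\ nbhs xbar V, nbhs ubar W &
      forall x x', (X `&` V) x -> (X `&` V) x' ->
        S x' `&` W `<=`
          [set u + (kappa * enorm (x' - x)) *: b
             | u in S x & b in @unit_ball R m]].

Definition lipschitz_like S X (xbar : 'rV[R]_n) (ubar : 'rV[R]_m) : Prop :=
  locally_closed_at (gph S) (row_mx xbar ubar) /\
  exists2 kappa : R, 0 <= kappa & lip_inclusion S X xbar ubar kappa.

Definition lip_modulus S X (xbar : 'rV[R]_n) (ubar : 'rV[R]_m) : \bar R :=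
  ereal_inf [set kappa%:E |
    kappa in [set k : R | 0 <= k /\ lip_inclusion S X xbar ubar k]].

(* D M x u ustar is the set of all xstar in D M(x | u)(ustar). *)
Definition coderivative_type :=
  ('rV[R]_n -> set 'rV[R]_m) -> 'rV[R]_n -> 'rV[R]_m -> 'rV[R]_m ->
  set 'rV[R]_n.

Definition coderivative : coderivative_type := fun M x u ustar =>
  [set xstar | normal_cone (gph M) (row_mx x u) (row_mx xstar (- ustar))].

Definition regular_coderivative : coderivative_type := fun M x u ustar =>
  [set xstar |
    regular_normal_cone (gph M) (row_mx x u) (row_mx xstar (- ustar))].

Definition prox_coderivative : coderivative_type := fun M x u ustar =>
  [set xstar |
    prox_normal_cone (gph M) (row_mx x u) (row_mx xstar (- ustar))].

Definition coderivative_bound (D : coderivative_type) S X (kappa : R)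
    (x : 'rV[R]_n) (u : 'rV[R]_m) : Prop :=
  forall ustar xstar, D (restr S X) x u ustar xstar ->
    enorm (projpt (tangent_cone X x) xstar) <= kappa * enorm ustar.

Definition coderivative_criterion (D : coderivative_type) S X
    (xbar : 'rV[R]_n) (ubar : 'rV[R]_m) : Prop :=
  exists2 kappa : R, 0 <= kappa &
    \forall z \near within (gph (restr S X)) (nbhs (row_mx xbar ubar)),
      coderivative_bound D S X kappa (lsubmx z) (rsubmx z).

(* [maxe 0] makes the supremum over an empty set 0; [ereal_sup set0] is -oo. *)
Definition coderivative_sup (D : coderivative_type) S X
    (x : 'rV[R]_n) (u : 'rV[R]_m) : \bar R :=
  ereal_sup [set maxe 0%E
      (ereal_sup [set (enorm (projpt (tangent_cone X x) xstar))%:E |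
         xstar in D (restr S X) x u ustar])
    | ustar in @unit_ball R m].

Definition coderivative_limsup (D : coderivative_type) S X
    (xbar : 'rV[R]_n) (ubar : 'rV[R]_m) : \bar R :=
  limf_esup (fun z => coderivative_sup D S X (lsubmx z) (rsubmx z))
    (within (gph (restr S X)) (nbhs (row_mx xbar ubar))).

End Mappings.

Arguments coderivative {R n m}.
Arguments regular_coderivative {R n m}.
Arguments prox_coderivative {R n m}.

(* Main.v *)
Require Import Defs.
From mathcomp Require Import all_boot all_order all_algebra ring lra.
From mathcomp Require Import boolp classical_sets functions.
From mathcomp Require Import reals ereal topology normedtype sequences convex.
From mathcomp Require Import derive realfun interval_inference.
Import Order.TTheory GRing.Theory Num.Theory.
Import numFieldNormedType.Exports.

Set Implicit Arguments.
Unset Strict Implicit.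
Unset Printing Implicit Defensive.

Local Open Scope classical_set_scope.
Local Open Scope ring_scope.

(** Why the theorem holds.  Write [G] for the graph of the restriction of [S] to
    [X], and consider a normal [(p, - q)] to [G] at [(x, u)].

    Since [X] is convex, Moreau decomposition for the closed convex cone
    [T_X(x)] shows that [|proj_{T_X(x)}(p)| <= c] holds if and only if
    [<p, y - x> <= c |y - x|] for all [y] in [X] ([enorm_projpt_leP]).  In this
    form the criterion, with [c = k |q|], no longer mentions the tangent cone,
    and both sides of the inequality are continuous in [(x, p, q)].

    Necessity.  If the Lipschitz inclusion holds with rate [k], moving from [x]
    towards [y] in [X] produces points of [G] whose difference quotients
    accumulate at a tangent vector [(y - x, b)] of [G] with
    [|b| <= k |y - x|].  A regular normal makes a nonpositive product with it,
    which is the bound ([lip_regular_bound]).  By continuity the bound passes to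
    limiting normals ([near_limiting_bound]).

    Sufficiency.  Suppose the bound holds at rate [k] for proximal normals, let
    [k < L < K], and let [u'] belong to [S x'] with [x' <> x].  Minimize
    [L |y - x| + sqrt (|v - u'|^2 + eps^2)] over the points [(y, v)] of [G] near
    [(xbar, ubar)].  If [y <> x], minus the gradient at the minimizer is a
    proximal normal ([penalty_min_prox_normal]); its first component is [L]
    times the unit vector from [y] to [x], its second one has norm at most 1,
    so that the bound tested at [x] gives [L <= k].  Hence [y = x], and
    comparison with the value at [(x', u')] gives [|v - u'| <= K |x - x'|] when
    [eps = (K - L) |x - x'|] ([prox_bound_lip]).

    Proximal normals are regular and regular normals are limiting, so all three
    versions follow at once ([coderivative_characterization]).  Both directions
    keep track of the rate, which yields the formula for the modulus. *)

(** * Euclidean geometry of row vectors *)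

Section EuclideanGeometry.
Variables (R : realType) (d : nat).
Implicit Types (A X : set 'rV[R]_d) (x y v w : 'rV[R]_d).

Lemma dotvC v w : dotv v w = dotv w v.
Proof. by apply: eq_bigr => i _; rewrite mulrC. Qed.

Lemma dotvDl v1 v2 w : dotv (v1 + v2) w = dotv v1 w + dotv v2 w.
Proof. by rewrite -big_split; apply: eq_bigr => i _; rewrite mxE mulrDl. Qed.

Lemma dotvZl (a : R) v w : dotv (a *: v) w = a * dotv v w.
Proof. by rewrite mulr_sumr; apply: eq_bigr => i _; rewrite mxE mulrA. Qed.

Lemma dotvNl v w : dotv (- v) w = - dotv v w.
Proof. by rewrite -scaleN1r dotvZl mulN1r. Qed.

Lemma dotvDr v w1 w2 : dotv v (w1 + w2) = dotv v w1 + dotv v w2.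
Proof. by rewrite dotvC dotvDl ![dotv _ v]dotvC. Qed.

Lemma dotvZr (a : R) v w : dotv v (a *: w) = a * dotv v w.
Proof. by rewrite dotvC dotvZl dotvC. Qed.

Lemma dotvNr v w : dotv v (- w) = - dotv v w.
Proof. by rewrite dotvC dotvNl dotvC. Qed.

Definition dotvE := (dotvDl, dotvDr, dotvZl, dotvZr, dotvNl, dotvNr).

Lemma dotv_ge0 v : 0 <= dotv v v.
Proof. by apply: sumr_ge0 => i _; rewrite -expr2 sqr_ge0. Qed.

Lemma enorm_ge0 v : 0 <= enorm v.
Proof. exact: sqrtr_ge0. Qed.

Lemma sqr_enorm v : enorm v ^+ 2 = dotv v v.
Proof. by rewrite sqr_sqrtr// dotv_ge0. Qed.

Lemma enorm0 : enorm (0 : 'rV[R]_d) = 0.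
Proof. by rewrite /enorm -(scale0r (0 : 'rV[R]_d)) dotvZl mul0r sqrtr0. Qed.

Lemma enormZ (a : R) v : enorm (a *: v) = `|a| * enorm v.
Proof. by rewrite /enorm dotvZl dotvZr mulrA -expr2 sqrtrM ?sqr_ge0// sqrtr_sqr. Qed.

Lemma enormN v : enorm (- v) = enorm v.
Proof. by rewrite /enorm dotvNl dotvNr opprK. Qed.

Lemma enormB v w : enorm (v - w) = enorm (w - v).
Proof. by rewrite -enormN opprB. Qed.

Lemma normr_coord_le v i : `|v 0 i| <= enorm v.
Proof.
rewrite -sqrtr_sqr ler_sqrt ?dotv_ge0// /dotv (bigD1 i)//= -expr2 lerDl.
by apply: sumr_ge0 => j _; rewrite -expr2 sqr_ge0.
Qed.

Lemma enorm_eq0 v : enorm v = 0 -> v = 0.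
Proof.
move=> v0; apply/rowP => i; rewrite mxE; apply/normr0_eq0/le_anti.
by rewrite normr_ge0 andbT -v0 normr_coord_le.
Qed.

Lemma enorm_gt0 v : v != 0 -> 0 < enorm v.
Proof.
by move=> v0; rewrite lt_def enorm_ge0 andbT; apply: contra_neq v0 => /enorm_eq0.
Qed.

Lemma cauchy_schwarz v w : dotv v w <= enorm v * enorm w.
Proof.
have [->|v0] := eqVneq v 0; first by
  rewrite -(scale0r w) dotvZl scale0r enorm0 !mul0r.
have [->|w0] := eqVneq w 0; first by
  rewrite -(scale0r v) dotvZr scale0r enorm0 mul0r mulr0.
have := dotv_ge0 (enorm w *: v - enorm v *: w).
rewrite !dotvE -!sqr_enorm (dotvC w v).
have := mulr_gt0 (enorm_gt0 v0) (enorm_gt0 w0).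
set a := enorm v; set b := enorm w; set c := dotv v w => ab0 h.
have {}h : 0 <= (a * b) * (2 * (a * b - c)) by apply: le_trans h _; nra.
by move: h; rewrite pmulr_rge0// pmulr_rge0// subr_ge0.
Qed.

Lemma normr_dotv_le v w : `|dotv v w| <= enorm v * enorm w.
Proof. by rewrite ler_norml lerNl -dotvNl -{1}(enormN v) !cauchy_schwarz. Qed.

Lemma ler_enormD v w : enorm (v + w) <= enorm v + enorm w.
Proof.
rewrite -(@ler_pXn2r _ 2)// ?nnegrE ?addr_ge0 ?enorm_ge0//.
rewrite sqr_enorm !dotvE -!sqr_enorm (dotvC w v).
have := cauchy_schwarz v w; nra.
Qed.

Lemma ler_enormB v w : enorm v - enorm w <= enorm (v - w).
Proof. by rewrite lerBlDr (le_trans _ (ler_enormD _ _))// subrK. Qed.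

Lemma dist_enorm_triangle y v w : enorm (v - w) <= enorm (v - y) + enorm (y - w).
Proof. by rewrite (le_trans _ (ler_enormD _ _))// addrA subrK. Qed.

(** ** Topology *)

Lemma cvg_dotv (T : Type) (F : set_system T) {FF : Filter F}
    (f g : T -> 'rV[R]_d) v w : f @ F --> v -> g @ F --> w ->
  dotv (f t) (g t) @[t --> F] --> dotv v w.
Proof.
move=> fv gw; rewrite /dotv.
have step (r : seq 'I_d) : \sum_(i <- r) f t 0 i * g t 0 i @[t --> F] -->
    \sum_(i <- r) v 0 i * w 0 i.
  elim: r => [|i r IH].
    under eq_cvg do rewrite big_nil.
    by rewrite big_nil; exact: cvg_cst.
  under eq_cvg do rewrite big_cons.
  rewrite big_cons; apply: cvgD => //; apply: cvgM.
    exact: cvg_comp fv (@coord_continuous _ _ _ _ _ v).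
  exact: cvg_comp gw (@coord_continuous _ _ _ _ _ w).
exact: step.
Qed.

Lemma cvg_enorm (T : Type) (F : set_system T) {FF : Filter F}
    (f : T -> 'rV[R]_d) v : f @ F --> v -> enorm (f t) @[t --> F] --> enorm v.
Proof.
move=> fv; rewrite /enorm; apply: continuous_cvg; last exact: cvg_dotv.
exact: sqrt_continuous.
Qed.

Lemma normr_le_enorm v : `|v| <= enorm v.
Proof.
rewrite [leLHS]/Num.norm /= mx_normrE; apply/bigmax_leP; split=> [|[i j] _ /=].
  exact: enorm_ge0.
by rewrite ord1 normr_coord_le.
Qed.

Lemma continuous_dist_enorm x : continuous (fun y => enorm (y - x)).
Proof.
move=> y; apply: (@cvg_enorm _ (nbhs y) _ (fun z => z - x)).
by apply: (@cvgB R 'rV[R]_d _ (nbhs y) _ id (fun=> x)); [exact: cvg_id|exact: cvg_cst].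
Qed.

(** The supremum norm [`|v|] is at most [enorm v], and [enorm] is continuous for
    its topology. *)
Lemma nbhs_enormP x (A : set 'rV[R]_d) :
  nbhs x A <-> exists2 e : R, 0 < e & forall y, enorm (y - x) < e -> A y.
Proof.
split=> [/nbhs_normP [e /= e0 eA]|[e e0 eA]].
  exists e => // y yxe; apply: eA => /=.
  by rewrite -normrN opprB (le_lt_trans (normr_le_enorm _)).
have : enorm (y - x) @[y --> x] --> enorm (x - x).
  exact: continuous_dist_enorm.
rewrite subrr enorm0 => /cvgrPdist_lt /(_ _ e0); apply: filterS => y.
by rewrite sub0r normrN ger0_norm ?enorm_ge0// => /eA.
Qed.

Lemma cvg_enormP (v_ : nat -> 'rV[R]_d) v : v_ @ \oo --> v <->
  forall e : R, 0 < e -> \forall k \near \oo, enorm (v_ k - v) < e.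
Proof.
split=> [vv e e0|vv A /nbhs_enormP[e e0 eA]].
  by apply: (vv [set y | enorm (y - v) < e]); apply/nbhs_enormP; exists e.
by apply: filterS (vv _ e0) => k /eA.
Qed.

Lemma cvg_enorm_le (v_ : nat -> 'rV[R]_d) v :
  (forall k, enorm (v_ k - v) <= k.+1%:R^-1) -> v_ @ \oo --> v.
Proof.
move=> h; apply/cvg_enormP => e e0.
have /cvgrPdist_lt/(_ _ e0) := @cvg_harmonic R.
apply: filterS => k; rewrite sub0r normrN ger0_norm ?invr_ge0//; exact: le_lt_trans (h k).
Qed.

Lemma compact_enorm_ball A x r : closed A ->
  compact (A `&` [set y | enorm (y - x) <= r]).
Proof.
move=> clA; apply: bounded_closed_compact; last first.
  apply: closedI => //.
  have : closed ((fun y => enorm (y - x)) @^-1` [set s | s <= r]).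
    apply: closed_comp => [y _|]; last exact: closed_le.
    exact: continuous_dist_enorm.
  exact.
exists (r + enorm x); split; first exact: num_real.
move=> s rs y [_ /= yxr]; apply: le_trans (normr_le_enorm _) _.
have := ler_enormD (y - x) x; rewrite subrK => h.
by apply: le_trans h _; apply: le_trans (ltW rs); rewrite lerD2r.
Qed.

End EuclideanGeometry.

(** * Tangent and normal cones *)

(** Passage to the limit [t -> 0+] in a linear inequality. *)
Lemma le0_of_le_small (R : realFieldType) (a b : R) :
  (forall t, 0 < t -> t <= 1 -> a <= t * b) -> a <= 0.
Proof.
move=> h; rewrite leNgt; apply/negP => a0.
have ab0 : 0 < a + `|b| by rewrite ltr_pwDl.
have := h (a / (a + `|b|)) (divr_gt0 a0 ab0).
rewrite ler_pdivrMr// mul1r lerDl normr_ge0 => /(_ isT).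
rewrite mulrAC ler_pdivlMr// => h2.
have : a * b <= a * `|b| by rewrite ler_pM2l// ler_norm.
nra.
Qed.

Section Cones.
Variables (R : realType) (d : nat).
Implicit Types (A X : set 'rV[R]_d) (x y v w : 'rV[R]_d).

Lemma projset_nonempty A x : closed A -> A !=set0 -> projset A x !=set0.
Proof.
move=> clA [a Aa]; pose B := A `&` [set y | enorm (y - x) <= enorm (a - x)].
have cB : compact B by exact: compact_enorm_ball.
have [||p] := compact_EVT_min (f := fun y => enorm (y - x)) _ cB.
- by exists a; split => /=.
- by apply: continuous_subspaceT; exact: continuous_dist_enorm.
rewrite inE => -[Ap _] pmin; exists p; split=> // z Az.
rewrite enormB (enormB x z).
have [zB|/ltW az] := lerP (enorm (z - x)) (enorm (a - x)).
  by apply: pmin; rewrite inE.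
by apply: le_trans az; apply: pmin; rewrite inE; split=> /=.
Qed.

Lemma convex_setP X : convex_set X -> forall x y (l : R),
  X x -> X y -> 0 <= l -> l <= 1 -> X (l *: x + (1 - l) *: y).
Proof.
move=> cX x y l Xx Xy l0 l1.
by have := cX x y (Itv01 l0 l1); rewrite !inE; exact.
Qed.

(** For convex [X] the cone generated by [X - x] is dense in the tangent cone,
    which makes the tangent cone a closed convex cone. *)
Lemma tangent_cone_convexP X x w : convex_set X -> X x ->
  tangent_cone X x w <-> forall e : R, 0 < e -> exists s y,
    [/\ 0 <= s, X y & enorm (w - s *: (y - x)) < e].
Proof.
move=> cX Xx; split=> [[t_ [w_ [t0 _ wcvg Xtw]]] e e0|h].
  have /cvg_enormP/(_ e e0)[N _ Nw] := wcvg.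
  exists (t_ N)^-1, (x + t_ N *: w_ N); split=> //; first by rewrite invr_ge0 ltW.
  rewrite (addrC x) addrK scalerA mulVf ?gt_eqF// scale1r enormB.
  exact: (Nw N (leqnn N)).
have /choice[f fP] : forall k : nat, exists p : R * 'rV[R]_d,
    [/\ 0 <= p.1, X p.2 & enorm (w - p.1 *: (p.2 - x)) < k.+1%:R^-1].
  by move=> k; have [|s [y]] := h k.+1%:R^-1; [rewrite invr_gt0|exists (s, y)].
have f1 k : 0 < (f k).1 + 1 by have [f0 _ _] := fP k; rewrite ltr_wpDl.
(* steps so short that [t_k * s_k <= 1], hence [X] contains the points *)
exists (fun k => k.+1%:R^-1 * ((f k).1 + 1)^-1).
exists (fun k => (f k).1 *: ((f k).2 - x)); split.
- by move=> k; rewrite mulr_gt0// invr_gt0.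
- apply: (squeeze_cvgr _ (cvg_cst 0) (@cvg_harmonic R)).
  near=> k; rewrite mulr_ge0 ?invr_ge0// ?(ltW (f1 k))//=.
  rewrite ger_pMr ?invr_gt0// invf_le1//.
  by have [f0 _ _] := fP k; rewrite lerDr.
- by apply: cvg_enorm_le => k; rewrite enormB ltW//; have [] := fP k.
- move=> k; have [f0 Xf _] := fP k.
  set t := _ * _; have -> : x + t *: ((f k).1 *: ((f k).2 - x)) =
      (t * (f k).1) *: (f k).2 + (1 - t * (f k).1) *: x.
    by rewrite scalerA scalerBr scalerBl scale1r addrCA.
  have t0 : 0 <= t by rewrite mulr_ge0// invr_ge0 // ltW.
  apply: convex_setP => //; first exact: mulr_ge0.
  rewrite /t -mulrA; apply: mulr_ile1.
  - by rewrite invr_ge0.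
  - by rewrite mulr_ge0// invr_ge0 ltW.
  - by rewrite invf_le1// ler1n.
  - by rewrite mulrC ler_pdivrMr// mul1r lerDl.
Unshelve. all: by end_near. Qed.

Lemma tangent_cone_feasible X x y : convex_set X -> X x -> X y ->
  tangent_cone X x (y - x).
Proof.
move=> cX Xx Xy; apply/tangent_cone_convexP => // e e0; exists 1, y.
by split=> //; rewrite scale1r subrr enorm0.
Qed.

Lemma tangent_coneZ X x w (a : R) : convex_set X -> X x -> 0 <= a ->
  tangent_cone X x w -> tangent_cone X x (a *: w).
Proof.
move=> cX Xx a0 /tangent_cone_convexP-/(_ cX Xx) h.
apply/tangent_cone_convexP => // e e0.
have a1 : 0 < a + 1 by rewrite ltr_wpDl.
have [s [y [s0 Xy wy]]] := h (e / (a + 1)) (divr_gt0 e0 a1).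
exists (a * s), y; split=> //; first exact: mulr_ge0.
rewrite -scalerA -scalerBr enormZ ger0_norm//.
move: wy; rewrite ltr_pdivlMr//; have := enorm_ge0 (w - s *: (y - x)); nra.
Qed.

Lemma tangent_coneD X x w1 w2 : convex_set X -> X x ->
  tangent_cone X x w1 -> tangent_cone X x w2 -> tangent_cone X x (w1 + w2).
Proof.
move=> cX Xx /tangent_cone_convexP-/(_ cX Xx) h1.
move=> /tangent_cone_convexP-/(_ cX Xx) h2.
apply/tangent_cone_convexP => // e e0.
have e2 : 0 < e / 2 by rewrite divr_gt0.
have [s1 [y1 [s10 Xy1 wy1]]] := h1 _ e2.
have [s2 [y2 [s20 Xy2 wy2]]] := h2 _ e2.
have [s0|s_neq0] := eqVneq (s1 + s2) 0.
  have [s1E s2E] : s1 = 0 /\ s2 = 0 by split; lra.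
  exists 0, x; split=> //; rewrite scale0r subr0.
  move: wy1 wy2; rewrite s1E s2E !scale0r !subr0.
  have := ler_enormD w1 w2; lra.
have s_gt0 : 0 < s1 + s2 by rewrite lt_def s_neq0 addr_ge0.
exists (s1 + s2), ((s1 / (s1 + s2)) *: y1 + (1 - s1 / (s1 + s2)) *: y2); split.
- exact: ltW.
- apply: convex_setP => //; first by rewrite divr_ge0// ltW.
  by rewrite ler_pdivrMr// mul1r lerDl.
- have -> : w1 + w2 - (s1 + s2) *: (s1 / (s1 + s2) *: y1 +
      (1 - s1 / (s1 + s2)) *: y2 - x) =
      (w1 - s1 *: (y1 - x)) + (w2 - s2 *: (y2 - x)).
    by apply/rowP => i; rewrite !mxE; field.
  apply: le_lt_trans (ler_enormD _ _) _; lra.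
Qed.

Lemma closed_tangent_cone X x : convex_set X -> X x ->
  closed (tangent_cone X x).
Proof.
move=> cX Xx w wT; apply/tangent_cone_convexP => // e e0.
have e2 : 0 < e / 2 by rewrite divr_gt0.
have [|w' [/= /tangent_cone_convexP-/(_ cX Xx) h ww']] :=
    wT [set w' | enorm (w' - w) < e / 2].
  by apply/nbhs_enormP; exists (e / 2).
have [s [y [s0 Xy wy]]] := h _ e2.
exists s, y; split=> //.
apply: le_lt_trans (dist_enorm_triangle w' _ _) _.
by rewrite (enormB w); lra.
Qed.

(** Expand the square of the distance from [x] to [p + t *: w] and let [t]
    tend to 0. *)
Lemma projset_variational A x p w : projset A x p ->
  (forall t, 0 < t -> t <= 1 -> A (p + t *: w)) -> dotv (x - p) w <= 0.
Proof.
move=> [Ap pmin] Aw; rewrite -(pmulr_rle0 _ (ltr0n _ 2)).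
apply: (@le0_of_le_small _ _ (dotv w w)) => t t0 t1.
have := pmin _ (Aw t t0 t1).
rewrite -(@ler_pXn2r _ 2)// ?nnegrE ?enorm_ge0// !sqr_enorm.
have -> : x - (p + t *: w) = (x - p) - t *: w by rewrite opprD addrA.
move: (x - p) => z; rewrite !dotvE (dotvC w z) => h.
rewrite -(ler_pM2l t0); nra.
Qed.

(** Moreau decomposition turns the bound on the projection of [v] onto the
    tangent cone into a bound on the linear form [dotv v] along feasible
    directions.  In this form the projection, and with it the dependence on
    the cone, disappears. *)
Lemma enorm_projpt_leP X x v c : convex_set X -> X x -> 0 <= c ->
  enorm (projpt (tangent_cone X x) v) <= c <->
  forall y, X y -> dotv v (y - x) <= c * enorm (y - x).
Proof.
move=> cX Xx c0; set T := tangent_cone X x; set p := projpt T v.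
have Tfeas y : X y -> T (y - x) by exact: tangent_cone_feasible.
have pP : projset T v p.
  have [|q qP] := @projset_nonempty T v (closed_tangent_cone cX Xx).
    by exists (x - x); exact: Tfeas.
  by apply: xgetPex; exists q.
have Tp : T p by have [] := pP.
split=> [pc y Xy|vX].
  have : dotv (v - p) (y - x) <= 0.
    apply: (projset_variational pP) => t t0 _; apply: tangent_coneD => //.
    by apply: tangent_coneZ => //; [exact: ltW|exact: Tfeas].
  rewrite dotvDl dotvNl subr_le0 => /le_trans; apply.
  by apply: le_trans (cauchy_schwarz _ _) _; rewrite ler_wpM2r ?enorm_ge0.
have vp : dotv v p <= c * enorm p.
  rewrite -subr_le0.
  apply: (@le0_of_le_small _ _ (enorm v + c)) => t t0 _.
  have /tangent_cone_convexP-/(_ cX Xx)/(_ t t0)[s [y [s0 Xy py]]] := Tp.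
  have := cauchy_schwarz v (p - s *: (y - x)).
  have := ler_enormB (s *: (y - x)) p.
  rewrite (enormB _ p) enormZ ger0_norm// !dotvE.
  have := vX y Xy; rewrite !dotvE.
  have := enorm_ge0 v.
  move: py; set e := enorm (p - _).
  move: (enorm (y - x)) (enorm v) (enorm p) (dotv v p) (dotv v y) (dotv v x).
  move=> r1 r2 r3 r4 r5 r6 et r20 h1 h2 h3; nra.
have : dotv (v - p) (- p) <= 0.
  apply: (projset_variational pP) => t t0 t1.
  rewrite scalerN -{1}[p]scale1r -scalerBl; apply: tangent_coneZ => //.
  by rewrite subr_ge0.
rewrite !dotvE opprK -sqr_enorm => h.
have [->//|p0] := eqVneq (enorm p) 0.
have {p0} p_gt0 : 0 < enorm p by rewrite lt_def p0 enorm_ge0.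
rewrite -(ler_pM2r p_gt0); apply: le_trans vp; nra.
Qed.

(** Expanding the square of the distance from [x + t *: v] to [z] turns the
    nearest-point property into a quadratic bound on [dotv v], where
    [C = 1 / (2 * t)]. *)
Lemma prox_normal_coneP A x v : prox_normal_cone A x v <->
  A x /\ exists2 C, 0 < C &
    forall z, A z -> dotv v (z - x) <= C * dotv (z - x) (z - x).
Proof.
have key t z : 0 < t -> (enorm (x + t *: v - x) <= enorm (x + t *: v - z)) =
    (dotv v (z - x) <= (2 * t)^-1 * dotv (z - x) (z - x)).
  move=> t0; rewrite -(@ler_pXn2r _ 2)// ?nnegrE ?enorm_ge0// !sqr_enorm.
  have -> : x + t *: v - z = t *: v - (z - x).
    by rewrite opprB addrC addrCA addrA addrC.
  rewrite (addrC x) addrK; move: (z - x) => y.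
  rewrite [_^-1 * _]mulrC ler_pdivlMr ?mulr_gt0// !dotvE (dotvC y v).
  by apply/idP/idP; nra.
split=> [[t t0 [Ax xmin]]|[Ax [C C0 vC]]].
  split=> //; exists (2 * t)^-1 => [|z Az]; first by rewrite invr_gt0 mulr_gt0.
  by rewrite -key//; exact: xmin.
have t0 : 0 < (2 * C)^-1 by rewrite invr_gt0 mulr_gt0.
exists (2 * C)^-1 => //; split=> // z Az; rewrite key//.
by rewrite invfM invrK mulKf ?pnatr_eq0//; exact: vC.
Qed.

(** The proximal normal inequality needs to be checked near the base point
    only: far away the quadratic term dominates any linear form. *)
Lemma prox_normal_cone_local A a v (e C : R) :
  A a -> 0 < e -> 0 < C ->
  (forall z, A z -> enorm (z - a) < e ->
    dotv v (z - a) <= C * dotv (z - a) (z - a)) ->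
  prox_normal_cone A a v.
Proof.
move=> Aa e0 C0 vC; apply/prox_normal_coneP; split=> //.
have ve0 : 0 <= enorm v / e by rewrite divr_ge0 ?enorm_ge0// ltW.
exists (C + enorm v / e) => [|z Az]; first by rewrite ltr_pwDl.
have [ze|ez] := ltrP (enorm (z - a)) e.
  apply: le_trans (vC z Az ze) _.
  by rewrite ler_wpM2r ?dotv_ge0// lerDl.
apply: le_trans (cauchy_schwarz _ _) _.
rewrite -sqr_enorm mulrDl expr2 ler_wpDl ?mulr_ge0 ?enorm_ge0 ?(ltW C0)//.
by rewrite mulrA ler_wpM2r ?enorm_ge0// mulrAC ler_pdivlMr// ler_wpM2l ?enorm_ge0.
Qed.

Lemma prox_normal_coneZ A a v (t : R) : 0 < t ->
  prox_normal_cone A a v -> prox_normal_cone A a (t *: v).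
Proof.
move=> t0 /prox_normal_coneP[Aa [C C0 vC]]; apply/prox_normal_coneP; split=> //.
exists (t * C) => [|z Az]; first exact: mulr_gt0.
by rewrite dotvZl -mulrA ler_pM2l//; exact: vC.
Qed.

Lemma prox_normal_regular A x v :
  prox_normal_cone A x v -> regular_normal_cone A x v.
Proof.
move=> /prox_normal_coneP[_ [C C0 vC]] w [t_ [w_ [t0 tcvg wcvg Aw]]].
have rhs : C * (t_ k * dotv (w_ k) (w_ k)) @[k --> \oo] --> C * (0 * dotv w w).
  apply: cvgM; first exact: cvg_cst.
  by apply: cvgM => //; exact: cvg_dotv.
rewrite mul0r mulr0 in rhs.
apply: ler_cvg_to (cvg_dotv (cvg_cst v) wcvg) rhs _.
apply: nearW => k /=; rewrite -(ler_pM2l (t0 k)).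
have := vC _ (Aw k); rewrite (addrC x) addrK !dotvE => /le_trans; apply.
by rewrite le_eqVlt; apply/orP; left; apply/eqP; ring.
Qed.

Lemma regular_normal_limiting A x v : A x ->
  regular_normal_cone A x v -> normal_cone A x v.
Proof.
by move=> Ax vN; exists (fun=> x), (fun=> v); split=> //; exact: cvg_cst.
Qed.

(** Difference quotients along [t_k = 1 / (k + 1)] confined to a compact set
    [Q] accumulate at a tangent vector in [Q]. *)
Lemma tangent_cone_compact A Q x (w_ : nat -> 'rV[R]_d) : compact Q ->
  (forall k, Q (w_ k)) ->
  (\forall k \near \oo, A (x + k.+1%:R^-1 *: w_ k)) ->
  exists2 w, Q w & tangent_cone A x w.
Proof.
move=> cQ Qw [N _ Aw].
have Q_near : (w_ @ \oo) Q by exists 0%N => // k _; exact: Qw.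
have [w [Qw' wcl]] := cQ (w_ @ \oo) _ Q_near.
exists w => //.
have /choice[f fP] : forall k : nat, exists j,
    [/\ (k <= j)%N, (N <= j)%N & enorm (w_ j - w) <= k.+1%:R^-1].
  move=> k.
  have [||q [[j /= jk <-] qw]] := wcl (w_ @` [set j | (maxn k N <= j)%N])
      [set q | enorm (q - w) < k.+1%:R^-1].
  - by exists (maxn k N) => // j /= jk; exists j.
  - by apply/nbhs_enormP; exists k.+1%:R^-1 => //; rewrite invr_gt0.
  by exists j; move: jk; rewrite geq_max => /andP[? ?]; split=> //; exact: ltW.
exists (fun k => (f k).+1%:R^-1), (w_ \o f); split.
- by move=> k; rewrite invr_gt0.
- apply: (squeeze_cvgr _ (cvg_cst 0) (@cvg_harmonic R)).
  near=> k; rewrite invr_ge0 ler0n /= lef_pV2 ?posrE// ler_nat ltnS.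
  by have [] := fP k.
- by apply: cvg_enorm_le => k; have [] := fP k.
- by move=> k; have [_ Nf _] := fP k; exact: Aw.
Unshelve. all: by end_near. Qed.

End Cones.

(** * The product space and set-valued mappings *)

Section Product.
Variables (R : realType) (n m : nat).
Implicit Types (z : 'rV[R]_(n + m)) (x y : 'rV[R]_n) (u : 'rV[R]_m).

Lemma dotv_row_mx x1 x2 u1 u2 :
  dotv (row_mx x1 u1) (row_mx x2 u2) = dotv x1 x2 + dotv u1 u2.
Proof.
rewrite /dotv big_split_ord /=.
by congr (_ + _); apply: eq_bigr => i _; rewrite ?row_mxEl ?row_mxEr.
Qed.

Lemma dotv_submx z1 z2 : dotv z1 z2 =
  dotv (lsubmx z1) (lsubmx z2) + dotv (rsubmx z1) (rsubmx z2).
Proof. by rewrite -dotv_row_mx !hsubmxK. Qed.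

Lemma enorm_lsubmx_le z : enorm (lsubmx z) <= enorm z.
Proof.
by rewrite ler_sqrt ?dotv_ge0// [leRHS]dotv_submx lerDl dotv_ge0.
Qed.

Lemma enorm_rsubmx_le z : enorm (rsubmx z) <= enorm z.
Proof.
by rewrite ler_sqrt ?dotv_ge0// [leRHS]dotv_submx lerDr dotv_ge0.
Qed.

Lemma enorm_submx_le z : enorm z <= enorm (lsubmx z) + enorm (rsubmx z).
Proof.
rewrite -(@ler_pXn2r _ 2)// ?nnegrE ?addr_ge0 ?enorm_ge0//.
rewrite sqr_enorm dotv_submx -!sqr_enorm.
have := enorm_ge0 (lsubmx z); have := enorm_ge0 (rsubmx z); nra.
Qed.

Lemma lsubmx_continuous : continuous (lsubmx : 'rV[R]_(n + m) -> 'rV[R]_n).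
Proof.
move=> z A /nbhs_enormP[e e0 eA]; apply/nbhs_enormP; exists e => // z' z'z.
by apply: eA; rewrite -linearB; apply: le_lt_trans z'z; exact: enorm_lsubmx_le.
Qed.

Lemma rsubmx_continuous : continuous (rsubmx : 'rV[R]_(n + m) -> 'rV[R]_m).
Proof.
move=> z A /nbhs_enormP[e e0 eA]; apply/nbhs_enormP; exists e => // z' z'z.
by apply: eA; rewrite -linearB; apply: le_lt_trans z'z; exact: enorm_rsubmx_le.
Qed.

(** The objective of the variational argument: a multiple of the distance to
    [x], plus a smooth approximation of the distance to [u] whose gradient has
    norm less than 1. *)
Definition penalty (K eps : R) x u z : R :=
  K * enorm (lsubmx z - x) +
  Num.sqrt (enorm (rsubmx z - u) ^+ 2 + eps ^+ 2).

Lemma continuous_penalty K eps x u : continuous (penalty K eps x u).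
Proof.
have contl : continuous (fun z => enorm (lsubmx z - x)).
  move=> z; exact: (continuous_comp (@lsubmx_continuous z)
    (@continuous_dist_enorm _ _ x _)).
have contr : continuous (fun z => enorm (rsubmx z - u)).
  move=> z; exact: (continuous_comp (@rsubmx_continuous z)
    (@continuous_dist_enorm _ _ u _)).
move=> z; apply: (cvgD (cvgM (cvg_cst K) (contl z))).
apply: continuous_cvg; first exact: sqrt_continuous.
exact: (cvgD (cvgM (contr z) (contr z)) (cvg_cst _)).
Qed.

Lemma smooth_norm_gt0 (eps : R) u : 0 < eps ->
  0 < Num.sqrt (enorm u ^+ 2 + eps ^+ 2).
Proof. by move=> e0; rewrite sqrtr_gt0 ltr_wpDl ?sqr_ge0// exprn_gt0. Qed.

Lemma enorm_le_smooth_norm (eps : R) u :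
  enorm u <= Num.sqrt (enorm u ^+ 2 + eps ^+ 2).
Proof.
rewrite -[leLHS]ger0_norm ?enorm_ge0// -sqrtr_sqr ler_sqrt ?lerDl ?sqr_ge0//.
by rewrite addr_ge0 ?sqr_ge0.
Qed.

(** Fermat's rule: away from [lsubmx z = x] the penalty is differentiable with
    a Lipschitz gradient, so minus its gradient at a local minimizer over [G]
    is a proximal normal to [G], not merely a regular one. *)
Lemma penalty_min_prox_normal (G : set 'rV[R]_(n + m)) K eps x u z e :
  0 <= K -> 0 < eps -> 0 < e -> G z -> lsubmx z != x ->
  (forall z', G z' -> enorm (z' - z) < e ->
    penalty K eps x u z <= penalty K eps x u z') ->
  prox_normal_cone G z (row_mx
    ((K / enorm (lsubmx z - x)) *: (x - lsubmx z))
    ((Num.sqrt (enorm (rsubmx z - u) ^+ 2 + eps ^+ 2))^-1 *: (u - rsubmx z))).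
Proof.
move=> K0 eps0 e0 Gz zx zmin.
have r_gt0 : 0 < enorm (lsubmx z - x) by rewrite enorm_gt0 ?subr_eq0.
have g_gt0 := smooth_norm_gt0 (rsubmx z - u) eps0.
(* the tangent line of the concave square root at [b ^+ 2] lies above it *)
have tangent (a b : R) : 0 < b -> a <= b + (2 * b)^-1 * (a ^+ 2 - b ^+ 2).
  move=> b0; rewrite -subr_ge0.
  have -> : b + (2 * b)^-1 * (a ^+ 2 - b ^+ 2) - a = (2 * b)^-1 * (a - b) ^+ 2.
    by field; rewrite gt_eqF.
  by rewrite mulr_ge0 ?sqr_ge0// invr_ge0 mulr_ge0// ltW.
have expand k (p q c : 'rV[R]_k) : enorm (q - c) ^+ 2 - enorm (p - c) ^+ 2 =
    dotv (q - p) (q - p) - 2 * dotv (c - p) (q - p).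
  rewrite !sqr_enorm -[q - c](subrKA p) -(opprB c p).
  move: (q - p) (c - p) => v w; rewrite !dotvE (dotvC w v); ring.
move: zmin r_gt0 g_gt0; rewrite /penalty.
set r := enorm (lsubmx z - x); set g := Num.sqrt _ => zmin r0 g0.
pose C := K * (2 * r)^-1 + (2 * g)^-1.
have [a0 b0] : 0 <= K * (2 * r)^-1 /\ 0 < (2 * g)^-1.
  by rewrite mulr_ge0 ?invr_ge0 ?mulr_ge0 ?(ltW r0)// invr_gt0 mulr_gt0.
apply: (@prox_normal_cone_local _ _ _ _ _ e C) => //; first exact: ltr_wpDl.
move=> z' Gz' z'z.
have le_r := tangent (enorm (lsubmx z' - x)) _ r0.
have le_g := tangent (Num.sqrt (enorm (rsubmx z' - u) ^+ 2 + eps ^+ 2)) _ g0.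
rewrite expand in le_r.
have sqrE (c : 'rV[R]_m) :
    Num.sqrt (enorm c ^+ 2 + eps ^+ 2) ^+ 2 = enorm c ^+ 2 + eps ^+ 2.
  by rewrite sqr_sqrtr// addr_ge0 ?sqr_ge0.
rewrite {3}/g !sqrE opprD addrACA subrr addr0 expand in le_g.
have {le_r le_g} := le_trans (zmin z' Gz' z'z) (lerD (ler_wpM2l K0 le_r) le_g).
rewrite -[X in _ -> dotv _ X <= _](hsubmxK (z' - z)) dotv_row_mx dotv_submx.
have -> : lsubmx (z' - z) = lsubmx z' - lsubmx z by exact: linearB.
have -> : rsubmx (z' - z) = rsubmx z' - rsubmx z by exact: linearB.
have := dotv_ge0 (lsubmx z' - lsubmx z); have := dotv_ge0 (rsubmx z' - rsubmx z).
rewrite /C !dotvZl.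
have -> : K / r = 2 * (K * (2 * r)^-1) by field; rewrite gt_eqF.
have -> : g^-1 = 2 * (2 * g)^-1 by field; rewrite gt_eqF.
rewrite mulrDr [K * (_ * (_ - _))]mulrA.
move: (K * (2 * r)^-1) (2 * g)^-1 a0 b0 => a b a0 b0.
move: (dotv _ _) (dotv _ _) (dotv _ _) (dotv _ _) => p q s t.
nra.
Qed.

End Product.

(** * The relative coderivative criterion *)

Section Criterion.
Variables (R : realType) (n m : nat).
Variables (S : 'rV[R]_n -> set 'rV[R]_m) (X : set 'rV[R]_n).
Hypotheses (cX : convex_set X).

Implicit Types z : 'rV[R]_(n + m).

Local Notation G := (gph (restr S X)).

Lemma gph_restrE z : G z <-> X (lsubmx z) /\ S (lsubmx z) (rsubmx z).
Proof.
rewrite /gph /restr /patch /=; case: ifPn => [|/negP h].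
  by rewrite inE => Xz; split=> [|[]].
by split=> // -[Xz _]; apply: h; rewrite inE.
Qed.

(** The three coderivatives are the values of this construction at the three
    notions of normal cone, up to conversion. *)
Definition cone_coderivative
    (N : set 'rV[R]_(n + m) -> 'rV[R]_(n + m) -> set 'rV[R]_(n + m)) :
    coderivative_type R n m :=
  fun M x u ustar => [set xstar | N (gph M) (row_mx x u) (row_mx xstar (- ustar))].

(** The coderivative estimate for a cone [N] of normals at [z], freed of the
    projection by [enorm_projpt_leP]; [rsubmx v] is [- ustar], which has the
    same norm as [ustar]. *)
Definition normal_bound (k : R) (N : set 'rV[R]_(n + m))
    (z : 'rV[R]_(n + m)) : Prop :=
  forall v, N v -> forall y, X y ->
    dotv (lsubmx v) (y - lsubmx z) <=
    k * enorm (rsubmx v) * enorm (y - lsubmx z).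

Lemma coderivative_boundP N k z : 0 <= k -> G z ->
  coderivative_bound (cone_coderivative N) S X k (lsubmx z) (rsubmx z) <->
  normal_bound k (N G z) z.
Proof.
move=> k0 /gph_restrE[Xz Sz]; split=> [Nk v Nv|Nk us xs].
  have := Nk (- rsubmx v) (lsubmx v).
  rewrite /cone_coderivative /= opprK !hsubmxK enormN => /(_ Nv).
  by rewrite enorm_projpt_leP// mulr_ge0 ?enorm_ge0.
rewrite /cone_coderivative /= hsubmxK => /Nk.
rewrite row_mxKl row_mxKr enormN => h.
by apply/enorm_projpt_leP => //; rewrite mulr_ge0 ?enorm_ge0.
Qed.

(** Moving from [x] towards [y] inside [X], the Lipschitz inclusion at rate
    [k] produces graph points whose difference quotients accumulate at a
    tangent [row_mx (y - x) b] with [enorm b <= k * enorm (y - x)]. *)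
Lemma lip_regular_bound k V W z : 0 <= k -> G z ->
  nbhs (lsubmx z) V -> nbhs (rsubmx z) W ->
  (forall x x', (X `&` V) x -> (X `&` V) x' -> S x' `&` W `<=`
     [set u + (k * enorm (x' - x)) *: b | u in S x & b in @unit_ball R m]) ->
  normal_bound k (regular_normal_cone G z) z.
Proof.
move=> k0 /gph_restrE[]; set x := lsubmx z; set u := rsubmx z => Xx Sx Vx Wu.
move=> lip v Nv y Xy.
pose x_ (i : nat) := x + i.+1%:R^-1 *: (y - x).
pose r := k * enorm (y - x).
have i0 i : 0 < i.+1%:R^-1 :> R by rewrite invr_gt0.
have Xx_ i : X (x_ i).
  rewrite /x_ scalerBr addrCA -[x in _ + (x - _)]scale1r -scalerBl.
  by apply: convex_setP => //; rewrite invf_le1// ler1n.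
(* [b = 0] is a placeholder for the finitely many [i] with [x_ i] outside [V] *)
have /choice[b_ b_P] : forall i, exists b, enorm b <= r /\
    (V (x_ i) -> S (x_ i) (u + i.+1%:R^-1 *: b)).
  move=> i; have [Vxi|nVxi] := pselect (V (x_ i)); last first.
    by exists 0; split=> //; rewrite enorm0 mulr_ge0 ?enorm_ge0.
  have SWu : (S x `&` W) u by split=> //; exact: nbhs_singleton.
  have XVx : (X `&` V) x by split=> //; exact: nbhs_singleton.
  have [w Sw [b /= b1 ub]] := lip (x_ i) x (conj (Xx_ i) Vxi) XVx u SWu.
  exists (- r *: b); split=> [|_].
    rewrite enormZ normrN ger0_norm ?mulr_ge0 ?enorm_ge0//.
    by rewrite ler_piMr// mulr_ge0 ?enorm_ge0.
  suff -> : u + i.+1%:R^-1 *: (- r *: b) = w by [].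
  rewrite -ub /x_ opprD addrA subrr sub0r enormN enormZ ger0_norm ?ltW//.
  rewrite scalerA mulrN scaleNr mulrCA -addrA.
  by rewrite /r addrN addr0.
pose Q := (lsubmx @^-1` [set y - x] : set 'rV[R]_(n + m)) `&`
  [set q | enorm (q - row_mx (y - x) 0) <= r].
have cQ : compact Q.
  apply: compact_enorm_ball; apply: closed_comp => [? _|].
    exact: lsubmx_continuous.
  exact: (accessible_closed_set1 (hausdorff_accessible (@norm_hausdorff _ _))).
have [i||w [/= wl wr] Tw] :=
    @tangent_cone_compact _ _ G _ z (fun i => row_mx (y - x) (b_ i)) cQ.
- split=> /=; first by rewrite row_mxKl.
  rewrite opp_row_mx add_row_mx subrr subr0 /enorm dotv_row_mx.
  rewrite -(sqr_enorm 0) enorm0 expr0n add0r.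
  by have [] := b_P i.
- have : x_ @ \oo --> x.
    apply/cvg_enormP => e e0.
    have : (k.+1%:R^-1 * enorm (y - x)) @[k --> \oo] --> (0 * enorm (y - x) : R).
      by apply: cvgM; [exact: cvg_harmonic|exact: cvg_cst].
    rewrite mul0r => /cvgrPdist_lt/(_ e e0) [N _ Ne]; exists N => // i /Ne /=.
    rewrite sub0r normrN ger0_norm ?mulr_ge0 ?enorm_ge0 ?ltW//.
    by rewrite /x_ (addrC x) addrK enormZ ger0_norm// ltW.
  move=> /(_ V Vx) [N _ NV]; exists N => // i /NV Vxi; apply/gph_restrE.
  rewrite -[z]hsubmxK scale_row_mx add_row_mx row_mxKl row_mxKr.
  by split; [exact: Xx_|have [_] := b_P i; exact].
have := Nv w Tw; rewrite dotv_submx wl => h.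
have wr' : enorm (rsubmx w) <= r.
  apply: le_trans wr; apply: le_trans (enorm_rsubmx_le _).
  have -> : rsubmx (w - row_mx (y - x) 0) = rsubmx w - rsubmx (row_mx (y - x) 0).
    exact: linearB.
  by rewrite row_mxKr subr0.
have := normr_dotv_le (rsubmx v) (rsubmx w); rewrite ler_norml => /andP[h2 _].
have : dotv (lsubmx v) (y - x) <= enorm (rsubmx v) * r.
  have := ler_wpM2l (enorm_ge0 (rsubmx v)) wr'; lra.
by rewrite /r mulrA (mulrC _ k) .
Qed.

(** The projection-free bound is stable under limits of base points, because
    [y - x] remains feasible for fixed [y] when the base point [x] moves. *)
Lemma near_limiting_bound k (zbar : 'rV[R]_(n + m)) :
  (\forall z \near within G (nbhs zbar),
     normal_bound k (regular_normal_cone G z) z) ->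
  \forall z \near within G (nbhs zbar), normal_bound k (normal_cone G z) z.
Proof.
move=> /nbhs_interior; apply: filterS => z reg _ v [z_ [v_ [zz vv Gz Nz]]] y Xy.
have lz : (y - lsubmx (z_ i)) @[i --> \oo] --> y - lsubmx z.
  apply: (cvgB (cvg_cst y)).
  exact: (cvg_comp _ _ zz (@lsubmx_continuous _ _ _ z)).
have lv : lsubmx (v_ i) @[i --> \oo] --> lsubmx v.
  exact: (cvg_comp _ _ vv (@lsubmx_continuous _ _ _ v)).
have rv : rsubmx (v_ i) @[i --> \oo] --> rsubmx v.
  exact: (cvg_comp _ _ vv (@rsubmx_continuous _ _ _ v)).
apply: (ler_cvg_to (cvg_dotv lv lz)
  (cvgM (cvgM (cvg_cst k) (cvg_enorm rv)) (cvg_enorm lz))).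
by have [N _ Nreg] := zz _ reg; exists N => // i /Nreg /(_ (Gz i)); apply.
Qed.

(** A minimizer of the penalty over the graph near [(xbar, ubar)] must have [x]
    as first component: otherwise its proximal normal, tested in the feasible
    direction from the minimizer to [x], violates the bound at rate [k < L]. *)
Lemma prox_bound_lip k K xbar ubar : closed X ->
  locally_closed_at (gph S) (row_mx xbar ubar) ->
  0 <= k -> k < K ->
  (\forall z \near within G (nbhs (row_mx xbar ubar)),
     normal_bound k (prox_normal_cone G z) z) ->
  lip_inclusion S X xbar ubar K.
Proof.
move=> clX [U [nU clU clSU]] k0 kK bound.
set zbar := row_mx xbar ubar in nU bound *.
have /nbhs_enormP[r r0 rP] : nbhs zbar (U `&` [set z | G z ->
    normal_bound k (prox_normal_cone G z) z]) by exact: filterI.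
have clGU : closed (G `&` U).
  have -> : G `&` U = lsubmx @^-1` X `&` (gph S `&` U).
    by apply/seteqP; split=> z /=; rewrite gph_restrE /gph /=; tauto.
  apply: closedI => //; apply: closed_comp => // z _; exact: lsubmx_continuous.
pose B := G `&` U `&` [set z | enorm (z - zbar) <= r / 2].
have cB : compact B by exact: compact_enorm_ball.
have K0 : 0 < K by exact: le_lt_trans kK.
(* The gap between [L] and [K] pays for the smoothing of the distance. *)
pose L := (k + K) / 2.
have [kL LK L0] : [/\ k < L, L < K & 0 < L] by rewrite /L; split; lra.
(* With this radius the minimizer stays at distance less than [r / 4] from
   [zbar], so it is a local minimizer over all of [G] and not only over [B]. *)
pose delta := r / (4 * (4 + 2 * K)).
have c0 : 0 < 4 * (4 + 2 * K) by lra.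
have delta0 : 0 < delta by rewrite divr_gt0.
have deltaE : 4 * delta + 2 * K * delta = r / 4.
  by rewrite /delta; field; lra.
have Kdelta0 : 0 < K * delta by exact: mulr_gt0.
exists [set x | enorm (x - xbar) < delta], [set u | enorm (u - ubar) < delta].
split; [by apply/nbhs_enormP; exists delta|by apply/nbhs_enormP; exists delta|].
move=> x x' [Xx /= xd] [Xx' /= x'd] u' [/= Su' u'd].
have [->|xx'] := eqVneq x x'.
  by exists u' => //; exists 0; rewrite ?scaler0 ?addr0// /unit_ball /= enorm0.
pose D := enorm (x' - x).
have D0 : 0 < D by rewrite enorm_gt0// subr_eq0 eq_sym.
have D2 : D < 2 * delta.
  have := dist_enorm_triangle xbar x' x; rewrite (enormB xbar) -/D; lra.
(* The penalty of [(x', u')] is then exactly [K * D]. *)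
pose eps := (K - L) * D.
have eps0 : 0 < eps by rewrite mulr_gt0// subr_gt0.
pose f := penalty L eps x u'.
have z'B : B (row_mx x' u').
  have zr : enorm (row_mx x' u' - zbar) < r / 2.
    apply: le_lt_trans (enorm_submx_le _) _.
    rewrite /zbar opp_row_mx add_row_mx row_mxKl row_mxKr; lra.
  split; last exact: ltW.
  split; first by apply/gph_restrE; rewrite row_mxKl row_mxKr.
  by have [|//] := rP (row_mx x' u'); lra.
have [||z] := compact_EVT_min (f := f) _ cB.
- by exists (row_mx x' u').
- by apply: continuous_subspaceT; exact: continuous_penalty.
rewrite inE => -[[Gz Uz] /= zr] zmin.
have fz : f z <= K * D.
  apply: le_trans (zmin (row_mx x' u') _) _; first by rewrite inE.
  rewrite /f /penalty row_mxKl row_mxKr subrr enorm0 expr0n add0r -/D.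
  by rewrite sqrtr_sqr ger0_norm ?(ltW eps0)// /eps; lra.
have [Xz Sz] : X (lsubmx z) /\ S (lsubmx z) (rsubmx z) by apply/gph_restrE.
have uz : enorm (rsubmx z - u') <= K * D.
  apply: le_trans fz; apply: le_trans (enorm_le_smooth_norm eps _) _.
  by rewrite lerDr mulr_ge0 ?enorm_ge0// ltW.
have [zx|zx] := eqVneq (lsubmx z) x.
  exists (rsubmx z); first by rewrite -zx.
  exists ((K * D)^-1 *: (u' - rsubmx z)); last first.
    by rewrite scalerA mulfV ?gt_eqF ?mulr_gt0// scale1r addrC subrK.
  rewrite /unit_ball /= enormZ ger0_norm ?invr_ge0 ?(ltW (mulr_gt0 K0 D0))//.
  by rewrite mulrC ler_pdivrMr ?mulr_gt0// mul1r enormB.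
have xz : enorm (lsubmx z - x) <= D.
  rewrite -(ler_pM2l L0).
  move: fz; rewrite /f /penalty.
  have : eps <= Num.sqrt (enorm (rsubmx z - u') ^+ 2 + eps ^+ 2).
    rewrite -[leLHS]ger0_norm ?(ltW eps0)// -sqrtr_sqr ler_sqrt ?lerDr ?sqr_ge0//.
    by rewrite addr_ge0 ?sqr_ge0.
  rewrite /eps; lra.
have z_near : enorm (z - zbar) < r / 4.
  apply: le_lt_trans (enorm_submx_le _) _.
  have -> : lsubmx (z - zbar) = lsubmx z - xbar.
    by rewrite linearB /= row_mxKl.
  have -> : rsubmx (z - zbar) = rsubmx z - ubar.
    by rewrite linearB /= row_mxKr.
  have := dist_enorm_triangle x (lsubmx z) xbar.
  have := dist_enorm_triangle u' (rsubmx z) ubar.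
  nra.
have r4 : 0 < r / 4 by rewrite divr_gt0.
have locmin z' : G z' -> enorm (z' - z) < r / 4 -> f z <= f z'.
  move=> Gz' z'z; apply: zmin; rewrite inE.
  have := dist_enorm_triangle z z' zbar => zz.
  have z'r : enorm (z' - zbar) < r / 2 by lra.
  by split; [split=> //; have [|//] := rP z'; lra|exact: ltW].
have Nz := penalty_min_prox_normal (ltW L0) eps0 r4 Gz zx locmin.
have [|_ /(_ Gz _ Nz x Xx)] := rP z; first by lra.
rewrite row_mxKl row_mxKr !dotvZl -sqr_enorm !enormZ (enormB x).
have r1 : 0 < enorm (lsubmx z - x) by rewrite enorm_gt0// subr_eq0.
have g0 := smooth_norm_gt0 (rsubmx z - u') eps0.
rewrite [X in k * (X * _)]ger0_norm ?invr_ge0 ?(ltW g0)//.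
have g1 : (Num.sqrt (enorm (rsubmx z - u') ^+ 2 + eps ^+ 2))^-1 *
    enorm (u' - rsubmx z) <= 1.
  by rewrite mulrC ler_pdivrMr// mul1r enormB enorm_le_smooth_norm.
rewrite expr2 mulrA divfK ?gt_eqF// ler_pM2r// => h.
have := ler_wpM2l k0 g1; lra.
Qed.

Lemma lip_near_bound k xbar ubar : 0 <= k -> lip_inclusion S X xbar ubar k ->
  \forall z \near within G (nbhs (row_mx xbar ubar)),
    normal_bound k (normal_cone G z) z.
Proof.
move=> k0 [V [W [nV nW lip]]]; apply: near_limiting_bound.
set zbar := row_mx xbar ubar.
have lV : nbhs zbar (lsubmx @^-1` V°).
  by apply: lsubmx_continuous; rewrite row_mxKl; exact: nbhs_interior.
have rW : nbhs zbar (rsubmx @^-1` W°).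
  by apply: rsubmx_continuous; rewrite row_mxKr; exact: nbhs_interior.
apply: filterS2 lV rW => z Vz Wz Gz.
exact: (lip_regular_bound k0 Gz Vz Wz lip).
Qed.

(** ** From pointwise bounds to the modulus *)

Lemma coderivative_sup_le (D : coderivative_type R n m) k x u : 0 <= k ->
  coderivative_bound D S X k x u -> (coderivative_sup D S X x u <= k%:E)%E.
Proof.
move=> k0 bound; apply: ge_ereal_sup => _ [us /= us1 <-].
rewrite ge_max lee_fin k0; apply: ge_ereal_sup => _ [xs /= Dxs <-].
rewrite lee_fin; apply: le_trans (bound _ _ Dxs) _.
by rewrite ler_piMr.
Qed.

Lemma coderivative_sup_ge0 (D : coderivative_type R n m) x u :
  (0 <= coderivative_sup D S X x u)%E.
Proof.
apply: le_trans (ereal_sup_ubound _); last first.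
  by exists 0; first by rewrite /unit_ball /= enorm0.
by rewrite le_max lexx.
Qed.

(** The supremum in the modulus formula only sees [ustar] in the unit ball;
    positive homogeneity of the proximal normal cone extends the bound to all
    [ustar], including [ustar = 0], which is reached by letting the scaling
    factor tend to infinity. *)
Lemma prox_bound_of_sup N k z : 0 <= k -> G z ->
  prox_normal_cone G z `<=` N G z ->
  (coderivative_sup (cone_coderivative N) S X (lsubmx z) (rsubmx z) <= k%:E)%E ->
  normal_bound k (prox_normal_cone G z) z.
Proof.
move=> k0 Gz sub_N sup_k v Nv y Xy; have [Xz _] := (gph_restrE z).1 Gz.
rewrite -subr_le0; set a := enorm (y - lsubmx z).
apply: (@le0_of_le_small _ _ (k * a)) => t t0 _.
pose s := enorm (rsubmx v) + t.
have s0 : 0 < s by rewrite ltr_wpDl ?enorm_ge0.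
have : enorm (projpt (tangent_cone X (lsubmx z)) (s^-1 *: lsubmx v)) <= k.
  rewrite -lee_fin; apply: le_trans sup_k.
  apply: le_trans (ereal_sup_ubound _); last first.
    exists (- (s^-1 *: rsubmx v)); last by [].
    rewrite /unit_ball /= enormN enormZ ger0_norm ?invr_ge0 ?(ltW s0)//.
    by rewrite mulrC ler_pdivrMr// mul1r lerDl ltW.
  rewrite le_max; apply/orP; right; apply: ereal_sup_ubound.
  exists (s^-1 *: lsubmx v) => //.
  rewrite /cone_coderivative /= opprK -scale_row_mx !hsubmxK; apply: sub_N.
  by apply: prox_normal_coneZ => //; rewrite invr_gt0.
move=> /enorm_projpt_leP-/(_ cX Xz k0 y Xy).
rewrite dotvZl mulrC ler_pdivrMr// -/a /s; lra.
Qed.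

(** Necessity is known for the largest cone, of limiting normals, and
    sufficiency for the smallest one, of proximal normals; hence both hold for
    every notion of normal cone in between. *)
Lemma coderivative_characterization N xbar ubar :
  X xbar -> S xbar ubar -> locally_closed_at (gph S) (row_mx xbar ubar) ->
  closed X ->
  (forall z, G z -> prox_normal_cone G z `<=` N G z) ->
  (forall z, G z -> N G z `<=` normal_cone G z) ->
  (lipschitz_like S X xbar ubar <->
     coderivative_criterion (cone_coderivative N) S X xbar ubar) /\
  lip_modulus S X xbar ubar =
    coderivative_limsup (cone_coderivative N) S X xbar ubar.
Proof.
move=> Xxbar Sxbar lcS clX prox_N N_lim; set zbar := row_mx xbar ubar.
have necessary k : 0 <= k -> lip_inclusion S X xbar ubar k ->
    \forall z \near within G (nbhs zbar),
      coderivative_bound (cone_coderivative N) S X k (lsubmx z) (rsubmx z).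
  move=> k0 /(lip_near_bound k0); rewrite !near_withinE.
  apply: filterS => z bound Gz.
  apply: (coderivative_boundP N k0 Gz).2 => v Nv.
  exact: bound Gz _ (N_lim _ Gz _ Nv).
split.
  split=> [[_ [k k0 lip]]|[k k0 bound]]; first by exists k => //; exact: necessary.
  split=> //; exists (k + 1); first by rewrite addr_ge0.
  apply: (prox_bound_lip clX lcS k0); first by rewrite ltrDl.
  move: bound; rewrite !near_withinE; apply: filterS => z bound Gz v.
  by move=> /(prox_N _ Gz); apply: (coderivative_boundP N k0 Gz).1; exact: bound.
apply/eqP; rewrite eq_le; apply/andP; split; last first.
  apply: le_ereal_inf_tmp => _ [k [k0 lip] <-].
  apply: le_trans (ereal_inf_lbound _) _.
    by exists [set z | coderivative_bound (cone_coderivative N) S X k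
      (lsubmx z) (rsubmx z)]; [exact: necessary|reflexivity].
  by apply: ge_ereal_sup => _ [z /= bound <-]; exact: coderivative_sup_le.
apply: le_ereal_inf_tmp => _ [A nA <-].
set f := (fun z : 'rV[R]_(n + m) => _).
have sup_A z : A z -> (f z <= ereal_sup (f @` A))%E.
  by move=> Az; apply: ereal_sup_ubound; exists z.
have : (0 <= ereal_sup (f @` A))%E.
  apply: le_trans (sup_A zbar _); first exact: coderivative_sup_ge0.
  by apply: (nbhs_singleton nA); apply/gph_restrE; rewrite row_mxKl row_mxKr.
case: (ereal_sup _) sup_A => [k| |] sup_A // k0; last exact: leey.
apply/lee_addgt0Pr => e e0; apply: ereal_inf_lbound.
exists (k + e) => //=; split; first by rewrite addr_ge0// ltW.
apply: (prox_bound_lip clX lcS (k := k)) => //; first by rewrite ltrDl.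
move: nA; rewrite near_withinE /within /=; apply: filterS => z Az Gz.
apply: prox_bound_of_sup (prox_N _ Gz) _ => //.
exact: sup_A (Az Gz).
Qed.

End Criterion.

Theorem theorem2p3 (R : realType) (n m : nat)
    (S : 'rV[R]_n -> set 'rV[R]_m) (X : set 'rV[R]_n)
    (xbar : 'rV[R]_n) (ubar : 'rV[R]_m)
    (xbarX : X xbar) (ubarS : S xbar ubar)
    (lcS : locally_closed_at (gph S) (row_mx xbar ubar))
    (clX : closed X) (cvX : convex_set X) :
  let equivalence D :=
    lipschitz_like S X xbar ubar <-> coderivative_criterion D S X xbar ubar in
  let modulus_formula D :=
    lip_modulus S X xbar ubar = coderivative_limsup D S X xbar ubar in
  [/\ equivalence coderivative /\ modulus_formula coderivative,
      equivalence regular_coderivative /\ modulus_formula regular_coderivative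
    & equivalence prox_coderivative /\ modulus_formula prox_coderivative].
Proof.
have prox_lim z : gph (restr S X) z ->
    prox_normal_cone (gph (restr S X)) z `<=` normal_cone (gph (restr S X)) z.
  by move=> Gz v /prox_normal_regular; exact: regular_normal_limiting.
have characterization N := @coderivative_characterization R n m S X cvX N
  xbar ubar xbarX ubarS lcS clX.
move=> equivalence modulus_formula; split.
- have lim_lim z : gph (restr S X) z -> normal_cone (gph (restr S X)) z `<=`
      normal_cone (gph (restr S X)) z by move=> _ v.
  exact: characterization prox_lim lim_lim.
- apply: (characterization (@regular_normal_cone R (n + m))) => z Gz v.
    exact: prox_normal_regular.
  exact: regular_normal_limiting.
- have prox_prox z : gph (restr S X) z -> prox_normal_cone (gph (restr S X)) z
      `<=` prox_normal_cone (gph (restr S X)) z by move=> _ v.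
  exact: characterization prox_prox prox_lim.
Qed.
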